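(* Let $n \in \mathbb{N}$ and let $\{A_i\}_{i \in \mathcal{I}}$ be a finite collection of non-singular real diagonal $n \times n$ matrices, with pressure $P$ and $\sigma$-ordered pressures $P_\sigma$ ($\sigma \in S_n$). Then for all $s \in [0,\infty)$, $$P(s) = \max_{\sigma \in S_n} P_\sigma(s).$$
   Context: The index set $\mathcal{I}$ is finite and non-empty, and $\mathcal{I}^* = \bigcup_{k \geq 1} \mathcal{I}^k$ is the set of all finite words over $\mathcal{I}$. For $\mathbf{i} = (i_1,\dots,i_k) \in \mathcal{I}^*$ write $A_{\mathbf{i}} = A_{i_1} A_{i_2} \cdots A_{i_k}$, and let $\alpha_1(\mathbf{i}) \geq \dots \geq \alpha_n(\mathbf{i}) > 0$ be the singular values of $A_{\mathbf{i}}$ (the positive square roots of the eigenvalues of $A_{\mathbf{i}}^T A_{\mathbf{i}}$, with multiplicity). For $s \in [0,n)$, the singular value function is $$\phi^s(\mathbf{i}) = \alpha_1(\mathbf{i}) \cdots \alpha_m(\mathbf{i})\, \alpha_{m+1}(\mathbf{i})^{s-m},$$ where $m \in \{0,\dots,n-1\}$ is the unique integer with $m \leq s < m+1$. The pressure $P:[0,\infty) \to \mathbb{R}$ of $\{A_i\}_{i\in\mathcal{I}}$ is $$P(s) = \lim_{k \to \infty} \frac{1}{k} \log \sum_{\mathbf{i} \in \mathcal{I}^k} \phi^s(\mathbf{i}) \quad (0 \leq s < n), \qquad P(s) = \log \sum_{i \in \mathcal{I}} |\det A_i|^{s/n} \quad (s \geq n).$$ The limit exists because $\phi^s$ is submultiplicative: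 $\phi^s(\mathbf{i}\,\mathbf{j}) \leq \phi^s(\mathbf{i})\phi^s(\mathbf{j})$. For diagonal matrices, $c_l(i) > 0$ denotes the absolute value of the $l$-th diagonal entry of $A_i$ ($l = 1,\dots,n$). Let $S_n$ be the symmetric group on $\{1,\dots,n\}$. For $\sigma \in S_n$, $s \in [0,n)$ and $m$ the integer with $m \leq s < m+1$, put $$\phi^s_\sigma(i) = c_{\sigma(1)}(i) \cdots c_{\sigma(m)}(i)\, c_{\sigma(m+1)}(i)^{s-m} \quad (i \in \mathcal{I}).$$ The $\sigma$-ordered pressure $P_\sigma : [0,\infty) \to \mathbb{R}$ is $P_\sigma(s) = \log \sum_{i \in \mathcal{I}} \phi^s_\sigma(i)$ for $s \in [0,n)$, and $P_\sigma(s) = P(s)$ for $s \geq n$. *)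

(* Defs.v *)
From mathcomp Require Import all_boot all_order all_algebra all_fingroup.
From mathcomp Require Import polyrcf.
From mathcomp Require Import all_classical all_reals all_analysis.
Import Order.TTheory GRing.Theory Num.Theory.
Import numFieldNormedType.Exports.

Set Implicit Arguments.
Unset Strict Implicit.
Unset Printing Implicit Defensive.

Local Open Scope classical_set_scope.
Local Open Scope ring_scope.

(* The real eigenvalues of M, each repeated according to its multiplicity as a
   root of the characteristic polynomial. *)
Definition real_spectrum (R : rcfType) (n : nat) (M : 'M[R]_n) : seq R :=
  flatten [seq nseq (mup x (char_poly M)) x | x <- rootsR (char_poly M)].

(* Nonincreasing, and indexed from 0: alpha_l(M) is (singular_values M)`_l.-1. *)
Definition singular_values (R : rcfType) (n : nat) (M : 'M[R]_n) : seq R :=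
  sort >=%R [seq Num.sqrt x | x <- real_spectrum (M^T *m M)].

(* a_1 ... a_m a_(m+1)^(s - m) with m the integer part of s, for the sequence
   a = [:: a_1; a_2; ...]; meaningful for 0 <= s < size a. *)
Definition interpolated_prod (R : realType) (a : seq R) (s : R) : R :=
  let m := Num.truncn s in (\prod_(l < m) a`_l) * a`_m `^ (s - m%:R).

Definition phi (R : realType) (n : nat) (s : R) (M : 'M[R]_n) : R :=
  interpolated_prod (singular_values M) s.

Definition word_mx (R : realType) (n : nat) (I : Type) (A : I -> 'M[R]_n)
    (w : seq I) : 'M[R]_n :=
  \big[mulmx/1%:M]_(i <- w) A i.

(* For s < n and invertible A i the limit exists, phi s being submultiplicative;
   limn is an arbitrary default value where there is no limit. *)
Definition pressure (R : realType) (n : nat) (I : finType) (A : I -> 'M[R]_n)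
    (s : R) : R :=
  if s < n%:R then
    limn (fun k : nat =>
      k%:R^-1 * ln (\sum_(w : k.-tuple I) phi s (word_mx A w)))
  else ln (\sum_(i : I) `|\det (A i)| `^ (s / n%:R)).

Definition diag_abs (R : realType) (n : nat) (I : Type) (A : I -> 'M[R]_n)
    (l : 'I_n) (i : I) : R := `|A i l l|.

Definition phi_perm (R : realType) (n : nat) (I : Type) (A : I -> 'M[R]_n)
    (sigma : 'S_n) (s : R) (i : I) : R :=
  interpolated_prod [seq diag_abs A (sigma l) i | l <- enum 'I_n] s.

Definition ordered_pressure (R : realType) (n : nat) (I : finType)
    (A : I -> 'M[R]_n) (sigma : 'S_n) (s : R) : R :=
  if s < n%:R then ln (\sum_(i : I) phi_perm A sigma s i)
  else pressure A s.

(* Maximum of F over S_n: the seed F 1 is itself one of the values. *)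
Definition max_perm (R : realType) (n : nat) (F : 'S_n -> R) : R :=
  \big[Num.max/F 1%g]_(sigma : 'S_n) F sigma.

(* Main.v *)
Require Import Defs.
From mathcomp Require Import all_boot all_order all_algebra all_fingroup.
From mathcomp Require Import polyrcf.
From mathcomp Require Import all_classical all_reals all_analysis.
Import Order.TTheory GRing.Theory Num.Theory.
Import numFieldNormedType.Exports.
Local Open Scope ring_scope.

Set Implicit Arguments.
Unset Strict Implicit.
Unset Printing Implicit Defensive.

(** For s >= n every ordered pressure is the pressure itself, so only s < n has
    content.  A word w in diagonal matrices is again diagonal, with the numbers
    c_l(w) = prod_(i in w) c_l(i) as absolute diagonal entries, and its singular
    values are these numbers in nonincreasing order.  Among all orderings of
    positive numbers the nonincreasing one maximizes
    a_1 ... a_m a_(m+1)^(s - m) (interpolated_prod_le_sort), and it is one of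
    the orderings, so

      phi^s(w) = max_sigma prod_(i in w) phi^s_sigma(i).

    Summing over the words of length k and writing
    T_sigma = sum_i phi^s_sigma(i), a single sigma bounds the sum from below by
    T_sigma^k, since a sum over words of products over letters is a power
    (sum_tuple_prod); replacing the maximum over sigma by the sum over sigma
    bounds it from above by n! (max_sigma T_sigma)^k.  The factor n! does not
    survive the k-th root (cvg_ln_root), so the limit is
    log (max_sigma T_sigma). *)

(** * Singular values of diagonal matrices *)

(** A split characteristic polynomial determines the spectrum: both sequences
    count each y with its multiplicity as a root. *)
Lemma perm_real_spectrum {R : rcfType} {n : nat} (M : 'M[R]_n) (r : seq R) :
  char_poly M = \prod_(x <- r) ('X - x%:P) -> perm_eq (real_spectrum M) r.
Proof.
move=> Mr; apply/allP => y _; apply/eqP; rewrite /= /real_spectrum.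
set p := char_poly M.
have p0 : p != 0 by rewrite monic_neq0 ?char_poly_monic.
have -> : count_mem y r = mup y p by rewrite /p Mr mu_prod_XsubC.
have memE z : (z \in rootsR p) = root p z.
  by rewrite -(roots_on_rootsR p0 z) in_itv.
rewrite count_flatten -map_comp sumnE big_map.
have [yr|yNr] := boolP (y \in rootsR p); last first.
  rewrite mupNroot -?memE// big_seq big1// => x xr /=.
  rewrite count_nseq /=; case: eqP => // xy.
  by rewrite -xy xr in yNr.
rewrite (bigD1_seq y) ?uniq_roots//= count_nseq /= eqxx mul1n.
by rewrite big1 ?addn0// => x /negPf xy; rewrite count_nseq /= xy.
Qed.

Lemma perm_sort_ge {R : realDomainType} (a b : seq R) :
  perm_eq a b -> sort >=%R a = sort >=%R b.
Proof.
move=> ab; apply/perm_sortP => //.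
- exact: ge_total.
- exact: ge_trans.
- exact: ge_anti.
Qed.

Lemma singular_values_diag {R : rcfType} {n : nat} (d : 'rV[R]_n) :
  singular_values (diag_mx d) = sort >=%R [seq `|d 0 l| | l <- enum 'I_n].
Proof.
apply: perm_sort_ge.
have -> : [seq `|d 0 l| | l <- enum 'I_n] =
    [seq Num.sqrt x | x <- [seq d 0 l ^+ 2 | l <- enum 'I_n]].
  by rewrite -[RHS]map_comp; apply: eq_map => l /=; rewrite sqrtr_sqr.
apply/perm_map/perm_real_spectrum.
rewrite tr_diag_mx mulmx_diag char_poly_trig ?diag_mx_is_trig// big_map big_enum.
by apply: eq_bigr => l _; rewrite !mxE eqxx mulr1n expr2.
Qed.

(** * The nonincreasing order maximizes the interpolated product *)

Section PrefixProducts.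
Context {R : realDomainType}.
Implicit Types a b : seq R.

(** Deleting terms of a nonincreasing sequence shifts later, smaller terms to
    the front. *)
Lemma subseq_nth_le a b (i : nat) : sorted >=%R b -> subseq a b ->
  (i < size a)%N -> a`_i <= b`_i.
Proof.
elim: b a i => [|y b IH] [|x a] i //= sb.
have sb' := path_sorted sb.
case: eqP => [-> ab|_ ab] ia; first by case: i ia => [//|i] /= ia; exact: IH.
have ib : (i < size b)%N by apply: leq_trans ia (size_subseq ab).
apply: le_trans (IH _ i sb' ab ia) _.
have := @sorted_leq_nth _ (>=%R) (@ge_trans _ R) (@ge_refl _ R) 0 (y :: b) sb i i.+1.
by rewrite !inE /= ltnS ltnW//=; apply.
Qed.

(** The first k terms of b, once sorted, form a subsequence of the sorted b, to
    which subseq_nth_le applies factor by factor. *)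
Lemma prod_prefix_le_sort b (k : nat) : {in b, forall x, 0 <= x} -> (k <= size b)%N ->
  \prod_(l < k) b`_l <= \prod_(l < k) (sort >=%R b)`_l.
Proof.
move=> b0 kb.
have szk : size (take k b) = k by rewrite size_take_min; apply/minn_idPl.
have -> : \prod_(l < k) b`_l = \prod_(x <- sort >=%R (take k b)) x.
  rewrite (perm_big (take k b)) ?perm_sort//= [RHS](big_nth 0) szk big_mkord.
  by apply: eq_bigr => l _; rewrite nth_take.
rewrite (big_nth 0) size_sort szk big_mkord; apply: ler_prod => l _.
apply/andP; split.
  apply: b0; apply: (@mem_take k); rewrite -(mem_sort >=%R).
  by rewrite mem_nth// size_sort szk.
apply: subseq_nth_le; rewrite ?size_sort ?szk//.
  exact/sort_sorted/ge_total.
apply: subseq_sort; [exact: ge_total|exact: ge_trans|exact: take_subseq].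
Qed.

End PrefixProducts.

Section InterpolatedProd.
Context {R : realType}.
Implicit Types (a b : seq R) (s t : R).

(** With x = a_1 ... a_m and y = a_(m+1), this writes the interpolated product as
    a weighted geometric mean of two consecutive prefix products, on which
    rearrangements are easy to compare. *)
Lemma powR_interpolation (x y t : R) : 0 < x -> 0 < y ->
  x * y `^ t = x `^ (1 - t) * (x * y) `^ t.
Proof.
move=> x0 y0; rewrite powRM ?ltW// mulrA -powRD; last by rewrite (gt_eqF x0) implybT.
by rewrite subrK powRr1// ltW.
Qed.

Lemma interpolated_prod_gt0 a s : {in a, forall x, 0 < x} -> 0 <= s < (size a)%:R ->
  0 < interpolated_prod a s.
Proof.
move=> a0 /andP[s0 sa]; have /andP[ms _] := truncn_itv s0.
have ma : (Num.truncn s < size a)%N by rewrite -(ltr_nat R); exact: le_lt_trans sa.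
apply: mulr_gt0; last by rewrite powR_gt0// a0// mem_nth.
by apply: prodr_gt0 => l _; rewrite a0// mem_nth// (ltn_trans (ltn_ord l)).
Qed.

(** Sorting raises both prefix products of the geometric mean, and for
    0 <= s - m <= 1 the mean is monotone in each of them. *)
Lemma interpolated_prod_le_sort a s : {in a, forall x, 0 < x} ->
  0 <= s < (size a)%:R ->
  interpolated_prod a s <= interpolated_prod (sort >=%R a) s.
Proof.
move=> a0 /andP[s0 sa]; have /andP[ms sm] := truncn_itv s0.
rewrite /interpolated_prod; set m := Num.truncn s; set b := sort _ a.
have ma : (m < size a)%N by rewrite -(ltr_nat R); exact: le_lt_trans sa.
have b0 : {in b, forall x, 0 < x} by move=> x; rewrite mem_sort; exact: a0.
have szb : size b = size a by rewrite size_sort.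
have prefix_gt0 (c : seq R) k : {in c, forall x, 0 < x} -> (k <= size c)%N ->
    0 < \prod_(l < k) c`_l.
  by move=> c0 kc; apply: prodr_gt0 => l _; rewrite c0// mem_nth// (leq_trans _ kc).
have prefix_le k : (k <= size a)%N -> \prod_(l < k) a`_l <= \prod_(l < k) b`_l.
  by move=> ka; apply: prod_prefix_le_sort => // x /a0/ltW.
have am0 : 0 < a`_m by rewrite a0// mem_nth.
have bm0 : 0 < b`_m by rewrite b0// mem_nth// szb.
have am0' : 0 < \prod_(l < m) a`_l by rewrite prefix_gt0// ltnW.
have bm0' : 0 < \prod_(l < m) b`_l by rewrite prefix_gt0// szb ltnW.
rewrite (powR_interpolation _ am0' am0) (powR_interpolation _ bm0' bm0).
have recr (c : seq R) : (\prod_(l < m) c`_l) * c`_m = \prod_(l < m.+1) c`_l.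
  by rewrite big_ord_recr.
rewrite !recr.
apply: ler_pM; rewrite ?powR_ge0//; apply: ge0_ler_powR; rewrite ?subr_ge0// ?nnegrE.
- by rewrite lerBlDr nat1r ltW.
- by rewrite ltW// prefix_gt0// ltnW.
- by rewrite ltW// prefix_gt0// szb ltnW.
- by rewrite prefix_le// ltnW.
- by rewrite ltW// prefix_gt0.
- by rewrite ltW// prefix_gt0// szb.
- exact: prefix_le.
Qed.

Lemma interpolated_prod_prod (L J : Type) (r : seq L) (w : seq J) (F : L -> J -> R) s :
  (forall l j, 0 <= F l j) -> 0 <= s < (size r)%:R ->
  interpolated_prod [seq \prod_(j <- w) F l j | l <- r] s =
  \prod_(j <- w) interpolated_prod [seq F l j | l <- r] s.
Proof.
move=> F0 /andP[s0 sr]; have /andP[ms _] := truncn_itv s0.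
case: r sr => [|l0 r] sr; first by have := le_lt_trans s0 sr; rewrite ltxx.
rewrite /interpolated_prod; set m := Num.truncn s.
have mr : (m < size (l0 :: r))%N by rewrite -(ltr_nat R); exact: le_lt_trans sr.
rewrite big_split exchange_big; congr (_ * _).
  apply: eq_bigr => l _; have lr := ltn_trans (ltn_ord l) mr.
  by rewrite (nth_map l0)//; apply: eq_bigr => j _; rewrite (nth_map l0).
rewrite (nth_map l0)//; under [RHS]eq_bigr do rewrite (nth_map l0)//.
elim: w => [|j w IH]; first by rewrite !big_nil powR1.
by rewrite !big_cons powRM ?prodr_ge0// IH.
Qed.

End InterpolatedProd.

(** * Reordering by permutations *)

Section Rearrangement.
Context {R : realType} {n : nat}.
Implicit Types (c : 'I_n -> R) (sigma : 'S_n) (s : R).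

Lemma perm_map_perm c sigma :
  perm_eq [seq c (sigma l) | l <- enum 'I_n] [seq c l | l <- enum 'I_n].
Proof.
rewrite (map_comp c sigma); apply/perm_map/uniq_perm; rewrite ?enum_uniq//.
  by rewrite map_inj_uniq ?enum_uniq//; exact: perm_inj.
move=> l; rewrite mem_enum; apply/mapP; exists ((sigma^-1)%g l).
  by rewrite mem_enum.
by rewrite permKV.
Qed.

Lemma sort_attained c :
  exists sigma, sort >=%R [seq c l | l <- enum 'I_n] = [seq c (sigma l) | l <- enum 'I_n].
Proof.
have /tuple_permP[sigma E] : perm_eq (sort >=%R [seq c l | l <- enum 'I_n]) [tuple c l | l < n].
  by rewrite perm_sort.
exists sigma; rewrite E; apply: eq_map => l /=.
by rewrite tnth_mktuple.
Qed.

Lemma interpolated_prod_perm_le c sigma s : (forall l, 0 < c l) -> 0 <= s < n%:R ->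
  interpolated_prod [seq c (sigma l) | l <- enum 'I_n] s <=
  interpolated_prod (sort >=%R [seq c l | l <- enum 'I_n]) s.
Proof.
move=> c0 sn; rewrite -(perm_sort_ge (perm_map_perm c sigma)).
apply: interpolated_prod_le_sort; last by rewrite size_map size_enum_ord.
by move=> _ /mapP[l _ ->].
Qed.

End Rearrangement.

Lemma max_perm_attained (R : realType) (n : nat) (F : 'S_n -> R) :
  exists2 sigma0, max_perm F = F sigma0 & forall sigma, F sigma <= F sigma0.
Proof.
rewrite /max_perm.
have [//|sigma0 _ F0] := @arg_maxP _ R _ (1%g : 'S_n) xpredT F.
exists sigma0 => [|sigma]; last exact: F0.
by apply: le_anti; rewrite le_bigmax bigmax_le// => *; exact: F0.
Qed.

(** * Sums over words and their growth rate *)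

Lemma sum_tuple_prod (R : comNzSemiRingType) (I : finType) (g : I -> R) (k : nat) :
  \sum_(w : k.-tuple I) \prod_(i <- w) g i = (\sum_i g i) ^+ k.
Proof.
have -> : (\sum_i g i) ^+ k = \prod_(j < k) \sum_i g i.
  by rewrite prodr_const card_ord.
rewrite bigA_distr_bigA (reindex (@finfun_of_tuple I k)) /=; last first.
  apply: onW_bij; exists (@tuple_of_finfun I k).
  - exact: finfun_of_tupleK.
  - exact: tuple_of_finfunK.
apply: eq_bigr => w _; rewrite big_tuple.
by apply: eq_bigr => j _; rewrite ffunE.
Qed.

(** The constant C contributes only k^-1 ln C, which tends to 0. *)
Lemma cvg_ln_root (R : realType) (S : nat -> R) (T C : R) : 0 < T -> 0 < C ->
  (forall k, T ^+ k <= S k <= C * T ^+ k) ->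
  (k%:R^-1 * ln (S k) @[k --> \oo] --> ln T)%classic.
Proof.
move=> T0 C0 TSC.
have Tk0 k : 0 < T ^+ k by rewrite exprn_gt0.
apply: (@squeeze_cvgr _ _ _ _ (fun=> ln T) (fun k : nat => k%:R^-1 * ln C + ln T)).
- near=> k; have /andP[TS SC] := TSC k.
  have k0 : (0 : R) < k%:R by rewrite ltr0n; near: k; exact: nbhs_infty_gt.
  have S0 : 0 < S k by exact: lt_le_trans TS.
  have lnTk : ln T = k%:R^-1 * ln (T ^+ k).
    by rewrite lnXn// -[ln T *+ k]mulr_natl mulKf// gt_eqF.
  rewrite lnTk -mulrDr -lnM ?posrE// !ler_pM2l ?invr_gt0//.
  by rewrite !ler_ln ?posrE ?mulr_gt0// TS SC.
- exact: cvg_cst.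
- rewrite -[X in (_ --> X)%classic]add0r -[X in (_ --> X + _)%classic](mul0r (ln C)).
  apply: cvgD; last exact: cvg_cst.
  apply: cvgM; last exact: cvg_cst.
  apply/gtr0_cvgV0; last exact: cvgr_idn.
  by near=> k; rewrite ltr0n; near: k; exact: nbhs_infty_gt.
Unshelve. all: by end_near. Qed.

(** * Pressure of a diagonal family *)

Section DiagonalFamily.
Context {R : realType} {n : nat} {I : finType} (A : I -> 'M[R]_n) (s : R).
Context (A_diag : forall i, is_diag_mx (A i)) (A_unit : forall i, A i \in unitmx).
Context (sn : 0 <= s < n%:R).

Lemma word_mx_diag (w : seq I) :
  word_mx A w = diag_mx (\row_l \prod_(i <- w) A i l l).
Proof.
rewrite /word_mx; elim: w => [|i w IH].
  rewrite big_nil -diag_const_mx; congr diag_mx.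
  by apply/rowP => l; rewrite !mxE big_nil.
have /diag_mxP[d Ai] := A_diag i.
rewrite big_cons IH Ai mulmx_diag; congr diag_mx.
by apply/rowP => l; rewrite !mxE big_cons Ai mxE eqxx mulr1n.
Qed.

Lemma diag_abs_gt0 (l : 'I_n) (i : I) : 0 < diag_abs A l i.
Proof.
have := A_unit i; rewrite unitmxE det_trig ?is_diag_mx_is_trig// unitfE.
by rewrite normr_gt0 => /prodf_neq0; apply.
Qed.

Lemma phi_word (w : seq I) : phi s (word_mx A w) =
  interpolated_prod (sort >=%R [seq \prod_(i <- w) diag_abs A l i | l <- enum 'I_n]) s.
Proof.
rewrite /phi word_mx_diag singular_values_diag; congr (interpolated_prod (sort _ _) s).
by apply: eq_map => l; rewrite mxE normr_prod.
Qed.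

(** For a fixed order sigma the interpolated product is multiplicative along
    words, whereas phi is only submultiplicative. *)
Lemma prod_phi_perm (sigma : 'S_n) (w : seq I) :
  \prod_(i <- w) phi_perm A sigma s i =
  interpolated_prod [seq \prod_(i <- w) diag_abs A (sigma l) i | l <- enum 'I_n] s.
Proof.
rewrite /phi_perm.
rewrite -(interpolated_prod_prod w (F := fun l i => diag_abs A (sigma l) i))//.
  by move=> l i; rewrite ltW// diag_abs_gt0.
by rewrite size_enum_ord.
Qed.

Lemma phi_perm_gt0 (sigma : 'S_n) (i : I) : 0 < phi_perm A sigma s i.
Proof.
apply: interpolated_prod_gt0; last by rewrite size_map size_enum_ord.
by move=> _ /mapP[l _ ->]; exact: diag_abs_gt0.
Qed.

Lemma prod_phi_perm_le_phi (sigma : 'S_n) (w : seq I) :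
  \prod_(i <- w) phi_perm A sigma s i <= phi s (word_mx A w).
Proof.
rewrite prod_phi_perm phi_word.
apply: (interpolated_prod_perm_le (c := fun l => \prod_(i <- w) diag_abs A l i)) => // l.
by apply: prodr_gt0 => i _; exact: diag_abs_gt0.
Qed.

Lemma phi_attained (w : seq I) :
  exists sigma : 'S_n, phi s (word_mx A w) = \prod_(i <- w) phi_perm A sigma s i.
Proof.
have [sigma E] := sort_attained (fun l => \prod_(i <- w) diag_abs A l i).
by exists sigma; rewrite prod_phi_perm phi_word E.
Qed.

Lemma phi_le_sum (w : seq I) :
  phi s (word_mx A w) <= \sum_(sigma : 'S_n) \prod_(i <- w) phi_perm A sigma s i.
Proof.
have [sigma ->] := phi_attained w.
rewrite (bigD1 sigma)//= lerDl sumr_ge0// => tau _.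
by apply: prodr_ge0 => i _; rewrite ltW// phi_perm_gt0.
Qed.

Lemma sum_phi_ge (sigma : 'S_n) (k : nat) :
  (\sum_i phi_perm A sigma s i) ^+ k <= \sum_(w : k.-tuple I) phi s (word_mx A w).
Proof.
by rewrite -sum_tuple_prod; apply: ler_sum => w _; exact: prod_phi_perm_le_phi.
Qed.

Lemma sum_phi_le (k : nat) :
  \sum_(w : k.-tuple I) phi s (word_mx A w) <=
  \sum_(sigma : 'S_n) (\sum_i phi_perm A sigma s i) ^+ k.
Proof.
under [leRHS]eq_bigr do rewrite -sum_tuple_prod.
by rewrite exchange_big; apply: ler_sum => w _; exact: phi_le_sum.
Qed.

(** sum_phi_ge and sum_phi_le enclose the sum over words of length k between
    T^k and n! T^k, with T the largest of the sums over letters. *)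
Lemma pressure_lt_n : (0 < #|I|)%N ->
  pressure A s = max_perm (fun sigma : 'S_n => ordered_pressure A sigma s).
Proof.
move=> /card_gt0P[i0 _].
pose T (sigma : 'S_n) := \sum_i phi_perm A sigma s i.
have T0 sigma : 0 < T sigma.
  rewrite /T (bigD1 i0)//= ltr_pwDl ?phi_perm_gt0// sumr_ge0// => i _.
  by rewrite ltW// phi_perm_gt0.
have s_lt_n : s < n%:R by case/andP: sn.
have [sigma0 ->] := max_perm_attained (fun sigma : 'S_n => ordered_pressure A sigma s).
rewrite /pressure /ordered_pressure s_lt_n -/(T sigma0) => Tmax.
apply: cvg_lim => //; apply: (cvg_ln_root (C := #|'S_n|%:R)) => // [|k].
  by rewrite ltr0n; apply/card_gt0P; exists 1%g.
rewrite sum_phi_ge/= (le_trans (sum_phi_le k))//.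
rewrite mulr_natl -sumr_const; apply: ler_sum => sigma _.
apply: lerXn2r; rewrite ?nnegrE; [exact/ltW/T0|exact/ltW/T0|].
by rewrite -ler_ln ?posrE; [exact: Tmax|exact: T0|exact: T0].
Qed.

End DiagonalFamily.

Theorem theorem2p1 (R : realType) (n : nat) (hn : (0 < n)%N)
    (I : finType) (hI : (0 < #|I|)%N) (A : I -> 'M[R]_n)
    (hdiag : forall i : I, is_diag_mx (A i))
    (hns : forall i : I, A i \in unitmx)
    (s : R) (hs : 0 <= s) :
  pressure A s = max_perm (fun sigma : 'S_n => ordered_pressure A sigma s).
Proof.
have [sn|ns] := boolP (s < n%:R); first by apply: pressure_lt_n => //; rewrite hs.
have [sigma0 -> _] := max_perm_attained (fun sigma : 'S_n => ordered_pressure A sigma s).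
by rewrite /ordered_pressure (negPf ns).
Qed.
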